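(* Let $V$ be an $n$-dimensional real vector space, and let $p_1,\ldots,p_d$ be positive real numbers with $p_1+\cdots+p_d=1$. Let $\mathcal{P}=\{(A_i^{(1)},\ldots,A_i^{(d)}):i\in[m]\}$ be a collection of $d$-tuples of subspaces of $V$ such that (i) for every $i\in[m]$, $\dim(A_i^{(1)}+\cdots+A_i^{(d)})=\dim(A_i^{(1)})+\cdots+\dim(A_i^{(d)})$; and (ii) for all $i<j$ in $[m]$ there exist $p<q$ in $[d]$ with $\dim(A_i^{(p)}\cap A_j^{(q)})>0$. Let $a_i^{(\ell)}=\dim(A_i^{(\ell)})$ for $\ell\in[d]$, $i\in[m]$. Then $$\sum_{i=1}^{m}\prod_{\ell=1}^{d}p_{\ell}^{a_i^{(\ell)}}\le 1.$$
   Context: $[m]=\{1,\ldots,m\}$, $[d]=\{1,\ldots,d\}$. A collection satisfying (i) and (ii) is called a skew Bollobás system of $d$-tuples of subspaces. *)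

(* Defs.v *)
From HB Require Import structures.
From mathcomp Require Import all_boot all_order all_algebra.
From mathcomp Require Import reals.
Set Implicit Arguments.
Unset Strict Implicit.
Unset Printing Implicit Defensive.
Import Order.TTheory GRing.Theory Num.Theory.
Local Open Scope ring_scope.

(* Members of the system are indexed by 'I_m and positions in a tuple by 'I_d;
   the shift from [m] and [d] to ranges starting at 0 preserves both strict
   orders. *)
Definition skew_bollobas_system (K : fieldType) (V : vectType K) (m d : nat)
    (A : 'I_m -> 'I_d -> {vspace V}) : Prop :=
  (forall i : 'I_m,
      \dim (\sum_(l < d) A i l)%VS = (\sum_(l < d) \dim (A i l))%N) /\
  (forall i j : 'I_m, (i < j)%N ->
      exists p q : 'I_d, (p < q)%N /\ (0 < \dim (A i p :&: A j q)%VS)%N).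

(* Main.v *)
Require Import Defs.
From HB Require Import structures.
From mathcomp Require Import all_boot all_order all_fingroup all_algebra.
From mathcomp Require Import zify.
From mathcomp Require Import reals.
Set Implicit Arguments.
Unset Strict Implicit.
Unset Printing Implicit Defensive.
Import Order.TTheory GRing.Theory Num.Theory.
Import passmx.
Local Open Scope ring_scope.

(**
Complete a basis of the direct sum of the A_i^(l) to a basis of V and colour the
added vectors arbitrarily: since the p_l sum to 1, replacing i by all these
colourings preserves the weight, and listing the colourings of the same i by
increasing sum of colours keeps the system skew.  So every member is a basis B_x
of V with a colouring of all its vectors, and it suffices to show that the
members whose colour classes have sizes a_1, ..., a_d number at most
n! / (a_1! ... a_d!), the number of colourings of that type: the multinomial
theorem then gives the bound.

For a fixed type, apply a generic linear map g to all bases, put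
n_l = a_l + ... + a_d, and let F(x, y) be the product over l < d of the n_l x n_l
determinants, in the last n_l coordinates, of the vectors of colour l of B_x g
followed by the vectors of colour > l of B_y g.  Genericity gives F(x, x) <> 0,
while F(x, y) = 0 as soon as a class p of x meets a class q > p of y.  So F is
triangular with nonzero diagonal.  Laplace expansion bounds the rank of the l-th
factor by binom(n_l, a_l), hence that of F by the multinomial coefficient.
*)

(** Equal fibre sizes make the two lists of values permutations of each other. This is what brings
    members of one type to a common colouring. *)
Lemma perm_of_fibers (n : nat) (T : eqType) (f g : 'I_n -> T) :
  (forall t, #|[set r | f r == t]| = #|[set r | g r == t]|) ->
  exists s : 'S_n, forall r, f (s r) = g r.
Proof.
move=> fg.
have count_fiber (h : 'I_n -> T) t :
    count_mem t [tuple h r | r < n] = #|[set r | h r == t]|.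
  by rewrite /= count_map -sum1_count big_enum_cond /= -sum1dep_card.
have /tuple_permP[s gs] : perm_eq [tuple g r | r < n] [tuple f r | r < n].
  by apply/allP => t _ /=; rewrite !count_fiber fg.
exists s => r; have /val_inj/(congr1 (fun t => tnth t r)) := gs.
by rewrite !tnth_mktuple.
Qed.

(** * Triangular arrays and factorization rank *)

Section Triangular.
Variables (R : fieldType) (T : finType).

Lemma triangular_card (D : {set T}) (K : finType) (h : T -> nat)
    (F : T -> T -> R) (U W : T -> K -> R) :
  (forall x y, F x y = \sum_k U x k * W y k) ->
  (forall x, x \in D -> F x x != 0) ->
  {in D &, forall x y, x != y -> (h x <= h y)%N -> F x y = 0} ->
  (#|D| <= #|K|)%N.
Proof.
move=> FE Fxx Fxy; rewrite leqNgt; apply/negP => ltKD.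
pose M : 'M[R]_(#|D|, #|K|) := \matrix_(i, k) U (enum_val i) (enum_val k).
have : kermx M != 0.
  by rewrite kermx_eq0 /row_free neq_ltn (leq_ltn_trans (rank_leq_col M)).
case/rowV0Pn => u /sub_kermxP uM /rV0Pn[i0 ui0].
(* A kernel vector [u] of the left factor is a linear relation among the rows of [F] indexed by
   [D]. *)
have uF y : \sum_i u 0 i * F (enum_val i) y = 0.
  under eq_bigr do rewrite FE mulr_sumr.
  rewrite exchange_big /= (reindex _ (onW_bij _ (@enum_val_bij K))) /=.
  apply: big1 => k _; under eq_bigr do rewrite mulrA.
  rewrite -mulr_suml; have := congr1 (fun v : 'rV_ _ => v 0 k) uM.
  by rewrite !mxE; under eq_bigr do rewrite mxE; move->; rewrite mul0r.
(* In the column of an index maximizing [h] on the support of [u], every off-diagonal term vanishes,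
   so the diagonal term would have to vanish too. *)
case: (@arg_maxnP _ i0 (fun i => u 0 i != 0) (fun i => h (enum_val i)) ui0) => i ui imax.
have := uF (enum_val i); rewrite (bigD1 i) //= big1 ?addr0 => [|j ji].
  by apply/eqP; rewrite mulf_neq0 // Fxx // enum_valP.
have [->|uj] := eqVneq (u 0 j) 0; first by rewrite mul0r.
rewrite Fxy ?mulr0 ?enum_valP ?imax //.
  by apply: contra ji => /eqP/enum_val_inj->.
exact: imax.
Qed.

(** This says that [F], seen as a matrix, has rank at most [N]; the explicit index type lets
    entrywise products be factored over pairs of indices. *)
Definition factors_through (N : nat) (F : T -> T -> R) :=
  exists K : finType, exists U W : T -> K -> R,
    #|K| = N /\ forall x y, F x y = \sum_k U x k * W y k.

Lemma factors_through1 : factors_through 1 (fun _ _ => 1).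
Proof.
exists 'I_1, (fun _ _ => 1), (fun _ _ => 1).
by split=> [|x y]; rewrite ?card_ord // big_ord1 mulr1.
Qed.

Lemma factors_throughM N1 N2 F1 F2 :
  factors_through N1 F1 -> factors_through N2 F2 ->
  factors_through (N1 * N2) (fun x y => F1 x y * F2 x y).
Proof.
move=> [K1 [U1 [W1 [c1 F1E]]]] [K2 [U2 [W2 [c2 F2E]]]].
exists (K1 * K2)%type, (fun x k => U1 x k.1 * U2 x k.2),
  (fun x k => W1 x k.1 * W2 x k.2); split=> [|x y]; first by rewrite card_prod c1 c2.
rewrite F1E F2E big_distrlr /= pair_big /=.
by apply: eq_bigr => k _; rewrite mulrACA.
Qed.

Lemma factors_through_prod (I : Type) (r : seq I) (N : I -> nat) F :
  (forall i, factors_through (N i) (F i)) ->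
  factors_through (\prod_(i <- r) N i) (fun x y => \prod_(i <- r) F i x y).
Proof.
move=> NF; elim: r => [|i r IHr].
  have [K [U [W [cK KE]]]] := factors_through1.
  by exists K, U, W; split=> [|x y]; rewrite big_nil.
have [K [U [W [cK KE]]]] := factors_throughM (NF i) IHr.
by exists K, U, W; split=> [|x y]; rewrite big_cons.
Qed.

Lemma factors_through_card N F (D : {set T}) (h : T -> nat) :
  factors_through N F ->
  (forall x, x \in D -> F x x != 0) ->
  {in D &, forall x y, x != y -> (h x <= h y)%N -> F x y = 0} ->
  (#|D| <= N)%N.
Proof. by move=> [K [U [W [<- FE]]]]; apply: triangular_card FE. Qed.

End Triangular.

(** * Laplace expansion along a set of rows *)

Section Laplace.
Variables (R : comNzRingType) (n : nat).
Implicit Types (M X Y : 'M[R]_n) (L S : {set 'I_n}).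

(** [M] is itself the product of the two matrices on the right. Padding with unit rows replaces the
    diagonal blocks, so no change of dimension occurs. *)
Lemma det_block_set M L :
  (forall r k, r \in L -> k \notin L -> M r k = 0) ->
  \det M = \det (\matrix_(r, k) if r \in L then M r k else (r == k)%:R)
         * \det (\matrix_(r, k) if r \in L then (r == k)%:R else M r k).
Proof.
move=> M0; rewrite -det_mulmx; congr (\det _); apply/matrixP => r k.
rewrite !mxE; under eq_bigr do rewrite !mxE.
have [rL|rL] := boolP (r \in L); last first.
  rewrite (bigD1 r) //= eqxx mul1r (negPf rL) big1 ?addr0 // => j jr.
  by rewrite eq_sym (negPf jr) mul0r.
have [kL|kL] := boolP (k \in L).
  rewrite (bigD1 k) //= kL eqxx mulr1 big1 ?addr0 // => j jk.
  have [jL|jL] := boolP (j \in L); first by rewrite (negPf jk) mulr0.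
  by rewrite M0 ?mul0r.
rewrite M0 // big1 // => j _; have [jL|jL] := boolP (j \in L).
  by case: eqP => [jk|_]; rewrite ?mulr0 //; move: kL; rewrite -jk jL.
by rewrite M0 ?mul0r.
Qed.

(** Permutations [s] are grouped by the image [S] of [L]: the mask for [S] kills exactly the terms
    with [s @: L != S]. *)
Lemma det_sum_mask M L :
  \det M = \sum_(S : {set 'I_n} | #|S| == #|L|)
             \det (\matrix_(r, k) (M r k *+ ((r \in L) == (k \in S)))).
Proof.
rewrite /determinant exchange_big /=; apply: eq_bigr => s _.
rewrite (bigD1 (s @: L)) ?card_imset //=; last exact: perm_inj.
rewrite [X in _ + X]big1 ?addr0 => [|S /andP[/eqP cS nS]].
  congr (_ * _); apply: eq_bigr => r _.
  by rewrite !mxE mem_imset ?eqxx //; apply: perm_inj.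
have /subsetPn[r rL rS] : ~~ (L \subset s @^-1: S).
  apply: contra nS => LS; rewrite eq_sym eqEcard cS.
  rewrite card_imset ?leqnn ?andbT; last exact: perm_inj.
  by apply/subsetP => _ /imsetP[r rL ->]; move: (subsetP LS r rL); rewrite inE.
rewrite inE in rS.
by rewrite [X in _ * X](bigD1 r) //= mxE rL (negPf rS) mulr0n mul0r mulr0.
Qed.

End Laplace.

Lemma perm_set_to (n : nat) (L S : {set 'I_n}) :
  #|S| = #|L| -> exists s : 'S_n, forall r, (s r \in S) = (r \in L).
Proof.
move=> cSL; apply: (@perm_of_fibers _ _ (fun r => r \in S) (fun r => r \in L)) => b.
have fiberE (A : {set 'I_n}) : #|[set r | (r \in A) == b]| = if b then #|A| else #|~: A|.
  by case: b; apply: eq_card => r; rewrite !inE; case: (r \in A).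
rewrite (fiberE S) (fiberE L) cSL; case: (b) => //.
by rewrite [LHS]cardsCs [RHS]cardsCs !setCK cSL.
Qed.

(** * Generic points for polynomial functions *)

Section Genericity.
Variables (R : numDomainType) (V : lmodType R).
Implicit Types F G : V -> R.

(** Univariate restrictions suffice for genericity, since two nonvanishing points can be joined by a
    line. *)
Definition polynomial_on_lines F :=
  forall g v, exists P : {poly R}, forall t, P.[t] = F (g + t *: v).

Lemma polynomial_on_linesM F G :
  polynomial_on_lines F -> polynomial_on_lines G ->
  polynomial_on_lines (fun g => F g * G g).
Proof.
move=> pF pG g v; have [P PE] := pF g v; have [Q QE] := pG g v.
by exists (P * Q) => t; rewrite hornerM PE QE.
Qed.

Lemma poly_exists_nonroot (P : {poly R}) : P != 0 -> exists t, P.[t] != 0.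
Proof.
move=> P0; have [rP|/allPn[t _ Pt]] :=
    boolP (all (root P) [seq k%:R | k <- iota 0 (size P)]); last by exists t.
suff /(max_poly_roots P0 rP) : uniq [seq (k%:R : R) | k <- iota 0 (size P)].
  by rewrite size_map size_iota ltnn.
by rewrite map_inj_uniq ?iota_uniq // => i j /eqP; rewrite eqr_nat => /eqP.
Qed.

Lemma polynomial_on_lines_nonzeroM F G :
  polynomial_on_lines F -> polynomial_on_lines G ->
  (exists g, F g != 0) -> (exists g, G g != 0) -> exists g, F g * G g != 0.
Proof.
move=> pF pG [f Ff] [g Gg].
(* On the line from [f] to [g], the restriction of [F] is nonzero at [t = 0] and that of [G] at
   [t = 1], so their product is a nonzero polynomial. *)
have [P PE] := polynomial_on_linesM pF pG f (g - f).
have [Pf PfE] := pF f (g - f); have [Pg PgE] := pG f (g - f).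
have Pf0 : Pf != 0.
  apply: contraNneq Ff => Pf0.
  by rewrite -[f]addr0 -[0](scale0r (g - f)) -PfE Pf0 horner0.
have Pg0 : Pg != 0.
  apply: contraNneq Gg => Pg0.
  by rewrite -[g](subrKC f) -[g - f](scale1r) -PgE Pg0 horner0.
have [t] := poly_exists_nonroot (mulf_neq0 Pf0 Pg0).
by rewrite hornerM PfE PgE; exists (f + t *: (g - f)).
Qed.

Lemma polynomial_on_lines_common_nonzero (I : eqType) (r : seq I) (F : I -> V -> R) :
  (forall i, i \in r -> polynomial_on_lines (F i)) ->
  (forall i, i \in r -> exists g, F i g != 0) ->
  exists g, forall i, i \in r -> F i g != 0.
Proof.
move=> pF Fnz.
suff [g] : exists g, \prod_(i <- r) F i g != 0.
  by rewrite prodf_seq_neq0 => /allP gF; exists g => i /gF.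
suff [] : polynomial_on_lines (fun g => \prod_(i <- r) F i g) /\
  exists g, \prod_(i <- r) F i g != 0 by [].
elim: r pF Fnz => [|i r IHr] pF Fnz.
  split; last by exists 0; rewrite big_nil oner_eq0.
  by move=> g v; exists 1 => t; rewrite big_nil hornerC.
have [||pr nzr] := IHr.
- by move=> j jr; apply: pF; rewrite inE jr orbT.
- by move=> j jr; apply: Fnz; rewrite inE jr orbT.
have ir : i \in i :: r by rewrite inE eqxx.
split.
  move=> g v; have [P PE] := polynomial_on_linesM (pF i ir) pr g v.
  by exists P => t; rewrite big_cons PE.
have [g nz] := polynomial_on_lines_nonzeroM (pF i ir) pr (Fnz i ir) nzr.
by exists g; rewrite big_cons.
Qed.

End Genericity.

(** * The determinants attached to a pair of coloured bases *)

Section Splice.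
Variables (R : numFieldType) (n : nat).
Implicit Types (c : 'I_n -> nat) (X Y : 'M[R]_n).

(* The unit rows stand in for the n_l x n_l minor on the indices with [l <= c r]. *)
Definition splice c (l : nat) X Y : 'M[R]_n :=
  \matrix_(r, k) if (c r < l)%N then (r == k)%:R
                 else if c r == l then X r k else Y r k.

(** Laplace expansion along the rows of colour [l]: each column set gives a minor of [X x] times one
    of [X y], and the unit rows leave only column sets inside [C]. *)
Lemma splice_factors (T : finType) (c : 'I_n -> nat) (l : nat) (X : T -> 'M[R]_n) :
  factors_through 'C(#|[set r | (l <= c r)%N]|, #|[set r | c r == l]|)
    (fun x y => \det (splice c l (X x) (X y))).
Proof.
set L := [set r | c r == l]; set C := [set r | (l <= c r)%N].
pose D := [set S : {set 'I_n} | S \subset C & #|S| == #|L|].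
have /fin_all_exists[sg sgP] (S : {set 'I_n}) :
    exists s : 'S_n, #|S| = #|L| -> forall r, (s r \in S) = (r \in L).
  have [/perm_set_to[s sP]|/eqP cS] := eqVneq #|S| #|L|; first by exists s.
  by exists 1%g => /cS.
pose U x (S : {set 'I_n}) := (-1) ^+ sg S *
  \det (\matrix_(r, k) if r \in L then X x r (sg S k) *+ (k \in L) else (r == k)%:R).
pose W y (S : {set 'I_n}) :=
  \det (\matrix_(r, k) if r \in L then (r == k)%:R else
     (if (c r < l)%N then (r == sg S k)%:R else X y r (sg S k)) *+ (k \notin L)).
exists 'I_#|D|, (fun x k => U x (enum_val k)), (fun y k => W y (enum_val k)).
split=> [|x y]; first by rewrite card_ord cards_draws.
transitivity (\sum_(S in D) U x S * W y S); last exact: big_enum_val.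
rewrite (det_sum_mask _ L) (bigID (fun S : {set 'I_n} => S \subset C)) /=.
rewrite [X in _ + X]big1 ?addr0.
  apply: eq_big => [S|S /andP[/eqP cS SC]]; first by rewrite inE andbC.
  (* Moving the columns of [S] to [L] makes the masked matrix block diagonal with respect to [L];
     the sign is absorbed in [U]. *)
  set M := (X in \det X); have -> : \det M = (-1) ^+ sg S * \det (col_perm (sg S) M).
    by rewrite col_permE det_mulmx det_perm odd_permV mulrCA -signr_addb addbb mulr1.
  rewrite (det_block_set (L := L)) => [|r k rL kL].
    rewrite /U /W mulrA; congr (_ * _ * _); congr (\det _);
      apply/matrixP => r k; rewrite !mxE.
      case: ifP => // rL; rewrite (sgP _ cS) rL; move: rL; rewrite inE => /eqP->.
      by rewrite ltnn eqxx; case: (k \in L).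
    case: ifP => // rL; rewrite (sgP _ cS) rL; move: rL; rewrite inE => ->.
    by case: (k \in L).
  by rewrite !mxE (sgP _ cS) rL (negPf kL).
(* If [S] contains some [r] outside [C], the mask erases the only nonzero entry of the unit row
   [r]. *)
move=> S /andP[/eqP cS /subsetPn[r rS]]; rewrite inE -ltnNge => rl.
rewrite (expand_det_row _ r) big1 // => k _; rewrite !mxE rl.
have [<-|_] := eqVneq r k; last by rewrite mul0rn mul0r.
by rewrite rS inE (ltn_eqF rl) mulr0n mul0r.
Qed.

(** The vector [u - w] is in the left kernel: [u] only sees rows taken from [X], and [w] only rows
    taken from [Y] because [p < q]. It is nonzero since the supports are disjoint. *)
Lemma splice_dependent c p q X Y (u w : 'rV[R]_n) :
  (p < q)%N -> u != 0 ->
  (forall r, u 0 r != 0 -> c r = p) -> (forall r, w 0 r != 0 -> c r = q) ->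
  u *m X = w *m Y -> \det (splice c p X Y) = 0.
Proof.
move=> pq u0 uP wP uXwY; apply/eqP/det0P; exists (u - w).
  apply: contraNneq u0 => /eqP; rewrite subr_eq0 => /eqP uw.
  apply/eqP/rowP => r; rewrite mxE; apply/eqP/negPn/negP => ur.
  have := wP r; rewrite -uw ur (uP r ur) => /(_ isT) pq'.
  by rewrite pq' ltnn in pq.
rewrite mulmxBl; apply/eqP; rewrite subr_eq0; apply/eqP.
transitivity (u *m X); last rewrite uXwY.
  apply/rowP => k; rewrite !mxE; apply: eq_bigr => r _; rewrite mxE.
  have [->|/uP->] := eqVneq (u 0 r) 0; first by rewrite !mul0r.
  by rewrite ltnn eqxx.
apply/rowP => k; rewrite !mxE; apply: eq_bigr => r _; rewrite mxE.
have [->|/wP->] := eqVneq (w 0 r) 0; first by rewrite !mul0r.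
by rewrite ltnNge ltnW //= gtn_eqF.
Qed.

Lemma splice1 c l : splice c l 1%:M 1%:M = 1%:M.
Proof. by apply/matrixP => r k; rewrite !mxE !if_same. Qed.

Lemma polynomial_on_lines_splice c l (B : 'M[R]_n) :
  polynomial_on_lines (fun g => \det (splice c l (B *m g) (B *m g))).
Proof.
move=> g v.
exists (\det (\matrix_(r, k) if (c r < l)%N then ((r == k)%:R)%:P
              else ((B *m g) r k)%:P + ((B *m v) r k)%:P * 'X)) => t.
rewrite -horner_evalE -det_map_mx; congr (\det _); apply/matrixP => r k.
rewrite !mxE /=; case: ifP => _; rewrite horner_evalE ?hornerE //.
rewrite if_same; under [RHS]eq_bigr do rewrite !mxE mulrDr.
rewrite big_split /= mulr_suml; congr (_ + _).
by apply: eq_bigr => j _; rewrite mulrA mulrAC.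
Qed.

Lemma skew_matrix_system_card (T : finType) (d : nat) (c : 'I_n -> nat)
    (D : {set T}) (B : T -> 'M[R]_n) (h : T -> nat) :
  {in D, forall x, B x \in unitmx} ->
  {in D &, forall x y, x != y -> (h x <= h y)%N ->
     exists p q, exists u w : 'rV[R]_n, (p < q <= d)%N /\
     [/\ u != 0, forall r, u 0 r != 0 -> c r = p,
         forall r, w 0 r != 0 -> c r = q & u *m B x = w *m B y]} ->
  (#|D| <= \prod_(l < d) 'C(#|[set r | (l <= c r)%N]|, #|[set r | c r == l]|))%N.
Proof.
move=> Bunit Bskew.
pose F (i : T * 'I_d) g := \det (splice c i.2 (B i.1 *m g) (B i.1 *m g)).
have [|i /[!mem_enum] iD|g Fg] := @polynomial_on_lines_common_nonzero R _ _
    (enum [pred i : T * 'I_d | i.1 \in D]) F.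
- by move=> i _; apply: polynomial_on_lines_splice.
(* At the inverse of the basis matrix the spliced matrix is the identity, so each diagonal factor is
   nonzero somewhere. *)
- by exists (invmx (B i.1)); rewrite /F mulmxV ?Bunit // splice1 det1 oner_neq0.
apply: (factors_through_card (h := h)
  (factors_through_prod _ (fun l : 'I_d => splice_factors c l (fun x => B x *m g)))).
  move=> x xD; apply/prodf_neq0 => l _; apply: (Fg (x, l)).
  by rewrite mem_enum.
move=> x y xD yD xy hxy.
have [p [q [u [w [/andP[pq qd] [u0 uP wP uw]]]]]] := Bskew x y xD yD xy hxy.
(* The factor of the smaller colour [p] vanishes; [p < q <= d] places [p] among the indices
   [l < d]. *)
rewrite (bigD1 (Ordinal (leq_trans pq qd))) //= (splice_dependent pq u0 uP wP) ?mul0r //.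
by rewrite !mulmxA uw.
Qed.

End Splice.

(** * Counting colourings with prescribed class sizes *)

Section Colorings.
Variables (n d : nat).
Implicit Types (c : {ffun 'I_n -> 'I_d.+1}) (S : {set 'I_n}).

(** Truncation at [j] merges the colours [>= j] of [c0]; these sets lead from the constant colouring
    ([j = 0]) to all colourings of the type of [c0] ([j = d]). *)
Let same_fibers (j : nat) (c0 : {ffun 'I_n -> 'I_d.+1}) : {set {ffun 'I_n -> 'I_d.+1}} :=
  [set c : {ffun 'I_n -> 'I_d.+1} | [forall l : 'I_d.+1,
     #|[set r | c r == l]| == #|[set r | minn (c0 r) j == l]|]].

(* Refines a coloring whose class [j] still stands for all the colors [>= j]. *)
Let split_class (j : nat) (cS : {ffun 'I_n -> 'I_d.+1} * {set 'I_n}) :=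
  [ffun r => if (cS.1 r == j :> nat) && (r \notin cS.2) then inord j.+1 : 'I_d.+1
             else cS.1 r].

Let same_fibers_le j c0 c r : c \in same_fibers j c0 -> (c r <= j)%N.
Proof.
rewrite inE => /forallP/(_ (c r))/eqP cc; have : (0 < #|[set r' | c r' == c r]|)%N.
  by apply/card_gt0P; exists r; rewrite inE.
by rewrite cc => /card_gt0P[s]; rewrite inE => /eqP<-; apply: geq_minr.
Qed.

(** Classes are chosen one after another: from the merged class [j], a subset of the prescribed size
    keeps colour [j] and the rest becomes class [j.+1]. Injectivity of this refinement gives the
    bound. *)
Lemma coloring_count c0 :
  (\prod_(l < d) 'C(#|[set r | (l <= c0 r)%N]|, #|[set r | c0 r == l :> nat]|) <=
   #|[set c : {ffun 'I_n -> 'I_d.+1} |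
       [forall l, #|[set r | c r == l]| == #|[set r | c0 r == l]|]]|)%N.
Proof.
suff /(_ d (leqnn d)) : forall j, (j <= d)%N ->
    (\prod_(l < j) 'C(#|[set r | (l <= c0 r)%N]|, #|[set r | c0 r == l :> nat]|) <=
     #|same_fibers j c0|)%N.
  move/leq_trans; apply; rewrite subset_leq_card //; apply/subsetP => c; rewrite !inE.
  move=> /forallP cc; apply/forallP => l; rewrite (eqP (cc l)); apply/eqP/eq_card => r.
  by rewrite !inE (minn_idPl _) // -ltnS.
elim=> [_|j IHj jd].
  rewrite big_ord0; apply/card_gt0P; exists [ffun=> ord0]; rewrite inE.
  apply/forallP => l; apply/eqP/eq_card => r.
  by rewrite !inE ffunE minn0 -val_eqE.
pose a := #|[set r | c0 r == j :> nat]|.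
pose draws c := [set S : {set 'I_n} | S \subset [set r | c r == j :> nat] & #|S| == a].
pose pairs := [set cS : {ffun 'I_n -> 'I_d.+1} * {set 'I_n} |
                 (cS.1 \in same_fibers j c0) && (cS.2 \in draws cS.1)].
have classj c : c \in same_fibers j c0 ->
    #|[set r | c r == j :> nat]| = #|[set r | (j <= c0 r)%N]|.
  rewrite inE => /forallP/(_ (inord j))/eqP cc.
  transitivity #|[set r | c r == inord j]|.
    by apply: eq_card => r; rewrite !inE -val_eqE /= inordK // ltnS ltnW.
  rewrite cc; apply: eq_card => r; rewrite !inE inordK ?ltnS ?(ltnW jd) //.
  by apply/eqP/idP => [/minn_idPr|/minn_idPr].
have card_pairs : #|pairs| =
    (#|same_fibers j c0| * 'C(#|[set r | (j <= c0 r)%N]|, a))%N.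
  transitivity (\sum_(c in same_fibers j c0) \sum_(S in draws c) 1)%N.
    by rewrite pair_big_dep sum1dep_card.
  rewrite -sum_nat_const.
  by apply: eq_bigr => c cP; rewrite sum1_card cards_draws classj.
rewrite big_ord_recr /= -/a; apply: leq_trans (_ : #|pairs| <= _)%N.
  by rewrite card_pairs leq_mul // IHj // ltnW.
have inord1 : (inord j.+1 : 'I_d.+1) = j.+1 :> nat by rewrite inordK.
have splitE cS r : cS \in pairs ->
    ((cS.1 r = j :> nat) *
       (split_class j cS r = (if r \in cS.2 then j else j.+1) :> nat) +
     (cS.1 r < j)%N * (split_class j cS r = cS.1 r) * (r \notin cS.2))%type.
  rewrite inE => /andP[cP]; rewrite inE => /andP[/subsetP Sj _].
  have crj := same_fibers_le r cP.
  rewrite ffunE; have [cj|cj] := eqVneq (cS.1 r : nat) j; [left|right].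
    by split=> //; case: (r \in cS.2).
  split; last by apply: contra cj => /Sj; rewrite inE.
  by rewrite /= ltn_neqAle cj crj.
(* No colour of [c] exceeds [j], so merging [j.+1] back into [j] recovers [c]; the class [j] of the
   image is [S]. *)
have split_inj : {in pairs &, injective (split_class j)}.
  move=> [c S] [c' S'] cS cS' /ffunP E; congr pair.
    apply/ffunP => r; apply/val_inj; have /(congr1 val) := E r.
    case: (splitE _ r cS) => /= [[-> ->]|[[lt ->] _]];
    case: (splitE _ r cS') => /= [[-> ->]|[[lt' ->] _]] //; case: ifP; lia.
  apply/setP => r; have /(congr1 val) := E r.
  by case: (splitE _ r cS) => /= [[_ ->]|[[lt ->] /negPf->]];
    case: (splitE _ r cS') => /= [[_ ->]|[[lt' ->] /negPf->]] //; do ?case: ifP; lia.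
rewrite -(card_in_imset split_inj) subset_leq_card //.
apply/subsetP => _ /imsetP[[c S] cS ->].
have splitr r := splitE _ r cS.
move: (cS); rewrite inE /= => /andP[cP]; rewrite inE => /andP[Sj /eqP Sa].
rewrite inE; apply/forallP => l; apply/eqP.
have cl : #|[set r | c r == l]| = #|[set r | minn (c0 r) j == l]|.
  by move: cP; rewrite inE => /forallP/(_ l)/eqP.
have [lj|jl|lj] := ltngtP l j.
- transitivity #|[set r | c r == l]|; last rewrite cl.
    apply: eq_card => r; rewrite !inE -!val_eqE /=.
    by case: (splitr r) => /= [[-> ->]|[[lt ->] _]] //; case: ifP; lia.
  by apply: eq_card => r; rewrite !inE; lia.
- have cl0 r : (c r == l) = false.
    by apply/negbTE; rewrite -val_eqE neq_ltn (leq_ltn_trans (same_fibers_le r cP)).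
  have [lj1|lj1] := eqVneq (l : nat) j.+1; last first.
    rewrite !eq_card0 // => r; rewrite !inE -?val_eqE /=; first by lia.
    by case: (splitr r) => /= [[_ ->]|[[lt ->] _]]; do ?case: ifP; lia.
  (* The new class [j.+1] is what [S] leaves of the merged class. *)
  transitivity #|[set r | c r == j :> nat] :\: S|.
    apply: eq_card => r; rewrite !inE -!val_eqE /=.
    by case: (splitr r) => /= [[-> ->]|[[lt ->] _]]; do ?case: ifP; lia.
  rewrite cardsD (setIidPr Sj) classj // Sa.
  rewrite (_ : [set r | minn (c0 r) j.+1 == l] =
     [set r | (j <= c0 r)%N] :\: [set r | c0 r == j :> nat]); last first.
    by apply/setP => r; rewrite !inE; lia.
  rewrite cardsD (setIidPr _) //.
  by apply/subsetP => r; rewrite !inE => /eqP->.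
- transitivity #|S|; last first.
    by rewrite Sa; apply: eq_card => r; rewrite !inE; lia.
  apply: eq_card => r; rewrite !inE -!val_eqE /=.
  by case: (splitr r) => /= [[_ ->]|[[lt ->] /negPf->]]; do ?case: ifP; lia.
Qed.

End Colorings.

(** * Bases adapted to a direct sum *)

Lemma adapted_basis (K : fieldType) (V : vectType K) (d : nat)
    (A : 'I_d -> {vspace V}) (phi := rVof (vbasis {:V})) :
  \dim (\sum_(l < d) A l)%VS = (\sum_(l < d) \dim (A l))%N ->
  exists BK : 'M[K]_(\dim {:V}) * {ffun 'I_(\dim {:V}) -> option 'I_d},
  [/\ BK.1 \in unitmx, forall l, #|[set r | BK.2 r == Some l]| = \dim (A l) &
      forall l x, x \in A l -> exists u : 'rV_(\dim {:V}),
        (forall r, u 0 r != 0 -> BK.2 r = Some l) /\ phi x = u *m BK.1].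
Proof.
move=> dimA; set S := (\sum_(l < d) A l)%VS in dimA.
pose tag (o : option 'I_d) := map (fun v : V => (v, o)).
(* Bases of the summands, completed by a basis of a complement. Each vector carries its colour, and
   [None] marks the added vectors. *)
pose L := \big[cat/[::]]_(l < d) tag (Some l) (vbasis (A l)) ++ tag None (vbasis S^C).
have tag1 o s : [seq x.1 | x <- tag o s] = s by rewrite -map_comp map_id.
have L_basis : basis_of fullv [seq x.1 | x <- L].
  rewrite map_cat tag1 (big_morph _ (@map_cat _ _ _) (erefl _)).
  under eq_bigr do rewrite tag1.
  rewrite -(addv_complf S); apply: cat_basis (vbasisP _).
    by apply/directv_addP/capv_compl.
  apply: bigcat_basis => [|l _]; last exact: vbasisP.
  by rewrite directvE /= dimA.
have size_L : size L == \dim {:V}.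
  by rewrite -(size_map fst); case/andP: L_basis => /eqP <-; rewrite eq_sym.
pose x r := tnth (Tuple size_L) r.
pose X := [tuple (x r).1 | r < \dim {:V}].
have XE : X = [seq y.1 | y <- L] :> seq V.
  rewrite /= (map_comp fst x) -[L]/(val (Tuple size_L)); congr map.
  exact: map_tnth_enum.
have X_free : free X by rewrite XE (basis_free L_basis).
have phi_lin (u : 'rV_(\dim {:V})) :
    u *m \matrix_r phi (x r).1 = phi (\sum_r u 0 r *: X`_r).
  rewrite /phi mulmx_sum_row linear_sum; apply: eq_bigr => r _.
  by rewrite rowK linearZ -tnth_nth tnth_mktuple.
exists (\matrix_r phi (x r).1, [ffun r => (x r).2]); split=> /=.
- rewrite unitmxE unitfE; apply/negP => /det0P[u u0]; rewrite phi_lin => /eqP.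
  rewrite rVof_eq0 ?vbasisP // => /eqP uX0; have u_eq0 := elimT freeP X_free _ uX0.
  by case/eqP: u0; apply/rowP => r; rewrite u_eq0 mxE.
- move=> l; transitivity (count (fun y => y.2 == Some l) L).
    rewrite -[L in RHS](map_tnth_enum (Tuple size_L)) count_map -sum1_count.
    rewrite big_enum_cond /= -sum1dep_card.
    by apply: eq_bigl => r; rewrite ffunE.
  rewrite /L count_cat (big_morph _ (count_cat _) (erefl _)) (bigD1 l) //=.
  rewrite count_map (eq_count (a2 := predT)) => [|v]; last by rewrite /= eqxx.
  rewrite count_predT size_tuple big1 => [|k kl].
    by rewrite count_map (eq_count (a2 := pred0)) // count_pred0 !addn0.
  rewrite count_map (eq_count (a2 := pred0)) ?count_pred0 // => v /=.
  by apply: contraNF kl => /eqP[->].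
- move=> l v vA.
  (* The basis vectors coloured [l] span [A l], so decomposing along their lines yields coefficients
     supported on that colour. *)
  have : (A l <= \sum_(r | [ffun r => (x r).2] r == Some l) <[(x r).1]>)%VS.
    rewrite -[X in (X <= _)%VS](span_basis (vbasisP _)); apply/span_subvP => w wA.
    have /tnthP[r xr] : (w, Some l) \in Tuple size_L.
      rewrite -[_ \in _]/(_ \in L) mem_cat (big_morph _ (mem_cat _) (in_nil _)) big_orE.
      by apply/orP; left; apply/existsP; exists l; apply: map_f.
    rewrite memvE (sumv_sup r) ?ffunE /x -?xr //.
  move=> /subvP/(_ v vA)/memv_sumP[vs vsP ->].
  have /fin_all_exists[u uP] r :
      exists k, [ffun r => (x r).2] r == Some l -> vs r = k *: (x r).1.
    have [/vsP/vlineP[k vk]|_] := boolP ([ffun r => (x r).2] r == Some l);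
      last by exists 0.
    by exists k.
  exists (\row_r (u r *+ ([ffun r => (x r).2] r == Some l))); split=> [r|].
    by rewrite mxE mulrb; case: ifP => [/eqP//|_]; rewrite eqxx.
  rewrite phi_lin; congr phi; rewrite big_mkcond; apply: eq_bigr => r _.
  rewrite -tnth_nth tnth_mktuple mxE.
  by rewrite mulrb; case: ifP => [/uP|]; rewrite ?scale0r.
Qed.
Lemma prod_pow_fibers (R : comNzRingType) (I J : finType) (P : I -> pred J) (p : J -> R) :
  \prod_j p j ^+ #|[set i | P i j]| = \prod_i \prod_(j | P i j) p j.
Proof.
rewrite [RHS](exchange_big_dep xpredT) //=; apply: eq_bigr => j _.
by rewrite -prodr_const; apply: eq_bigl => i; rewrite inE.
Qed.

(** * The weighted inequality for fully coloured bases *)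

Section Weighted.
Variables (R : realFieldType) (n d : nat).
Implicit Types c : {ffun 'I_n -> 'I_d.+1}.

(** Class sizes are kept in a finite type so that sums can be split by type; [inord] is harmless
    because no class has more than [n] elements. *)
Let type c : {ffun 'I_d.+1 -> 'I_n.+1} := [ffun l => inord #|[set r | c r == l]|].

Let typeE c l : type c l = #|[set r | c r == l]| :> nat.
Proof. by rewrite ffunE inordK // ltnS (leq_trans (max_card _)) // card_ord. Qed.

(** Weights depend only on the type, and the power on the right expands over all colourings. So it
    is enough to compare, type by type, the number of members with the number of colourings. *)
Lemma skew_colored_bases_weight (p : 'I_d.+1 -> R) (T : finType) (D : {set T})
    (B : T -> 'M[R]_n) (c : T -> {ffun 'I_n -> 'I_d.+1}) (h : T -> nat) :
  (forall l, 0 <= p l) ->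
  {in D, forall x, B x \in unitmx} ->
  {in D &, forall x y, x != y -> (h x <= h y)%N ->
     exists p q : 'I_d.+1, exists u w : 'rV[R]_n, (p < q)%N /\
     [/\ u != 0, forall r, u 0 r != 0 -> c x r = p,
         forall r, w 0 r != 0 -> c y r = q & u *m B x = w *m B y]} ->
  \sum_(x in D) \prod_r p (c x r) <= (\sum_l p l) ^+ n.
Proof.
move=> p_ge0 Bunit Bskew.
have weightE c' : \prod_r p (c' r) = \prod_l p l ^+ type c' l.
  under [RHS]eq_bigr do rewrite typeE.
  rewrite (prod_pow_fibers (fun r l => c' r == l)); apply: eq_bigr => r _.
  by under [RHS]eq_bigl do rewrite eq_sym; rewrite big_pred1_eq.
have -> : (\sum_l p l) ^+ n = \sum_(c' : {ffun 'I_n -> 'I_d.+1}) \prod_r p (c' r).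
  by rewrite -(bigA_distr_bigA (fun _ : 'I_n => p)) prodr_const card_ord.
rewrite (partition_big (type \o c) xpredT) //= [leRHS](partition_big type xpredT) //=.
apply: ler_sum => t _.
under eq_bigr => x /andP[_ /eqP xt] do rewrite weightE xt.
under [leRHS]eq_bigr => c' /eqP ct do rewrite weightE ct.
rewrite !sumr_const; apply: ler_wpMn2l.
  by apply: prodr_ge0 => l _; rewrite exprn_ge0.
have [x0 /andP[x0D /eqP x0t]|D0] := pickP [pred x in D | type (c x) == t];
  last by rewrite eq_card0.
pose c0 := c x0.
have cfib c' : type c' = t -> forall l, #|[set r | c' r == l]| = #|[set r | c0 r == l]|.
  by move=> ct l; rewrite -!typeE ct x0t.
have /fin_all_exists[s sP] (x : T) :
    exists s : 'S_n, type (c x) = t -> forall r, c x (s r) = c0 r.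
  have [/cfib/perm_of_fibers[s sP]|/eqP xt] := eqVneq (type (c x)) t; first by exists s.
  by exists 1%g => /xt.
pose Dt := [set x in D | type (c x) == t].
apply: (@leq_trans #|Dt|); first by rewrite cardsE.
(* Reordering the rows of [B x] by [s x] gives every member of the type the colouring [c0]. *)
apply: leq_trans (skew_matrix_system_card (D := Dt) (d := d) (c := fun r => c0 r)
  (h := h) (B := fun x => row_perm (s x) (B x)) _ _) _.
- move=> x; rewrite inE => /andP[/Bunit xB _].
  by rewrite row_permE unitmx_mul unitmx_perm.
- move=> x y; rewrite !inE => /andP[xD /eqP xt] /andP[yD /eqP yt] xy hxy.
  have [k [q [u [w [kq [u0 uk wq uw]]]]]] := Bskew x y xD yD xy hxy.
  (* Permuting coefficients along with rows preserves the common vector. *)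
  exists k, q, (col_perm (s x) u), (col_perm (s y) w).
  split; first by rewrite kq -ltnS ltn_ord.
  split.
  - have /rV0Pn[r ur] := u0; apply/rV0Pn; exists ((s x)^-1%g r).
    by rewrite mxE permKV.
  - by move=> r; rewrite mxE => /uk; rewrite sP // => ->.
  - by move=> r; rewrite mxE => /wq; rewrite sP // => ->.
  rewrite !row_permE !col_permE !mulmxA -!(mulmxA _ (perm_mx _) (perm_mx _)).
  by rewrite -!perm_mxM !mulVg !perm_mx1 !mulmx1.
apply: leq_trans (coloring_count c0) _; apply: subset_leq_card; apply/subsetP => c'.
rewrite inE => /forallP cc; rewrite -[_ \in _]/(type c' == t).
apply/eqP/ffunP => l; apply/val_inj.
by rewrite /= typeE (eqP (cc l)) -x0t typeE.
Qed.

End Weighted.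

(** * Passage from subspaces to coloured bases *)

Lemma extension_weight (R : realFieldType) (n d : nat) (p : 'I_d -> R)
    (k : 'I_n -> option 'I_d) :
  \sum_l p l = 1 ->
  \sum_(c in family (fun r => [pred l | (k r == None) || (k r == Some l)]))
     \prod_r p (c r) =
  \prod_l p l ^+ #|[set r | k r == Some l]|.
Proof.
move=> p1.
(* The sum splits into one factor per index: a forced colour contributes its own weight, a free
   index contributes the total weight 1. *)
rewrite -(bigA_distr_big_dep
  (fun r l => (k r == None) || (k r == Some l)) (fun _ => p)) /=.
rewrite (prod_pow_fibers (fun r l => k r == Some l)); apply: eq_bigr => r _.
case: (k r) => [l|]; last by rewrite big_pred0_eq p1.
by rewrite !(big_pred1 l) // => j; rewrite /= eq_sym.
Qed.

Theorem theorem1p12 (R : realType) (n : nat) (V : vectType R)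
    (hV : \dim {:V}%VS = n) (d : nat) (p : 'I_d -> R)
    (p_gt0 : forall l : 'I_d, 0 < p l) (p_sum : \sum_(l < d) p l = 1)
    (m : nat) (A : 'I_m -> 'I_d -> {vspace V})
    (hA : skew_bollobas_system A) :
  \sum_(i < m) \prod_(l < d) p l ^+ \dim (A i l) <= 1.
Proof.
have [A_direct A_skew] := hA.
case: d => [|d] in p p_gt0 p_sum A hA A_direct A_skew *.
  by move/eqP: p_sum; rewrite big_ord0 eq_sym oner_eq0.
have /fin_all_exists[BK BKP] i := adapted_basis (A_direct i).
set N := \dim {:V} in BK BKP.
pose extends (i : 'I_m) :=
  family (fun r => [pred l | ((BK i).2 r == None) || ((BK i).2 r == Some l)]).
have -> : \sum_(i < m) \prod_(l < d.+1) p l ^+ \dim (A i l) =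
    \sum_(x in [set x : 'I_m * {ffun 'I_N -> 'I_d.+1} | x.2 \in extends x.1])
      \prod_r p (x.2 r).
  under [RHS]eq_bigl do rewrite inE.
  rewrite -(pair_big_dep xpredT (fun i c => c \in extends i)
    (fun _ c => \prod_r p (c r))) /=.
  apply: eq_bigr => i _; rewrite extension_weight //.
  by apply: eq_bigr => l _; have [_ -> _] := BKP i.
rewrite -[leRHS](expr1n _ N) -[in leRHS]p_sum.
(* Lexicographic order, first by [i], then by sum of colours; that sum is at most [N * d], whence
   the multiplier. *)
pose h (x : 'I_m * {ffun 'I_N -> 'I_d.+1}) := (x.1 * (N * d).+1 + \sum_r x.2 r)%N.
apply: (skew_colored_bases_weight (B := fun x => (BK x.1).1) (c := snd) (h := h)).
- by move=> l; apply: ltW.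
- by move=> x _; have [] := BKP x.1.
move=> [i c] [j c']; rewrite !inE /= => /familyP ci /familyP c'j ne; rewrite /h /= => hij.
have sum_le (b : {ffun 'I_N -> 'I_d.+1}) : (\sum_r b r <= N * d)%N.
  rewrite -[N in (N * d)%N]card_ord -sum_nat_const; apply: leq_sum => r _.
  by rewrite -ltnS.
have [ij|ji|/val_inj eij] := ltngtP i j.
- have [k [q [kq]]] := A_skew i j ij; rewrite lt0n dimv_eq0 => kq0.
  set v := vpick (A i k :&: A j q)%VS.
  have : v \in (A i k :&: A j q)%VS by apply: memv_pick.
  rewrite memv_cap => /andP[vi vj].
  have [_ _ /(_ _ _ vi)[u [uk vu]]] := BKP i; have [_ _ /(_ _ _ vj)[w [wq vw]]] := BKP j.
  exists k, q, u, w; split=> //; split; last by rewrite -vu.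
  - apply: contra_neq kq0 => u0; apply/eqP; rewrite -vpick0 -/v.
    by rewrite -(rVof_eq0 (vbasisP _)) vu u0 mul0mx.
  - by move=> r /uk kr; move: (ci r); rewrite !inE kr => /orP[//|/eqP[]].
  - by move=> r /wq kr; move: (c'j r); rewrite !inE kr => /orP[//|/eqP[]].
- have := leq_mul ji (leqnn (N * d).+1); rewrite mulSn.
  move=> /leq_trans/(_ (leq_addr (\sum_r c r) _)).
  by move=> /leq_trans/(_ hij); rewrite addnC leq_add2l ltnNge sum_le.
rewrite -eij leq_add2l in hij; rewrite -eij.
have {}ne : c != c' by apply: contra_neq ne => ->; rewrite eij.
(* Otherwise [c'] is pointwise at most [c] while its sum is at least as large, forcing equality. The
   basis vector [r] itself then lies in class [c r] of one member and in the later class [c' r] of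
   the other. *)
have [r cr] : exists r, (c r < c' r)%N.
  apply/existsP; apply: contraNT ne; rewrite negb_exists => /forallP c'_le.
  have le r : (c' r <= c r)%N by rewrite leqNgt.
  have : (\sum_r (c r - c' r) == 0)%N.
    by rewrite sumnB // subn_eq0.
  rewrite sum_nat_eq0 => /forallP eq0; apply/eqP/ffunP => r; apply/val_inj/eqP.
  by rewrite /= eqn_leq le -subn_eq0 -(implyTb (_ == _)) eq0.
have delta_supp s : (delta_mx 0 r : 'rV[R]_N) 0 s != 0 -> s = r.
  by rewrite mxE eqxx /=; have [//|_] := eqVneq s r; rewrite eqxx.
exists (c r), (c' r), (delta_mx 0 r), (delta_mx 0 r); split=> //; split=> //.
- by apply/rV0Pn; exists r; rewrite mxE !eqxx oner_eq0.
- by move=> s /delta_supp->.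
- by move=> s /delta_supp->.
Qed.
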